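(* Let $L$ be a non-abelian finite-dimensional Lie algebra over a finite field $\mathbb{F}_q$. Then the non-commuting graph $G_L$ is connected.
   Context: $\mathbb{F}_q$ denotes the finite field with $q$ elements. For a Lie algebra $L$, $Z(L)=\{x\in L : [x,y]=0 \text{ for all } y\in L\}$ is its centre. The non-commuting graph $G_L$ is the undirected simple graph with vertex set $L\setminus Z(L)$, in which two distinct vertices $x$ and $y$ are adjacent if and only if $[x,y]\neq 0$. *)

(* Defs.v *)
From HB Require Import structures.
From mathcomp Require Import all_boot all_order all_algebra all_field.

Set Implicit Arguments.
Unset Strict Implicit.
Unset Printing Implicit Defensive.

Import GRing.Theory.
Local Open Scope ring_scope.

(* In every characteristic, including 2, the bracket is required to be
   alternating; antisymmetry (lieC below) then follows. *)
HB.mixin Record Lmodule_isLieAlgebra (K : fieldType) L of GRing.Lmodule K L := {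
  lie : L -> L -> L;
  lie_is_bilinear : bilinear_for *:%R *:%R lie;
  liexx : forall x, lie x x = 0;
  lie_jacobi : forall x y z,
    lie x (lie y z) + lie y (lie z x) + lie z (lie x y) = 0
}.

#[short(type="lieAlgType")]
HB.structure Definition LieAlgebra (K : fieldType) :=
  { L of GRing.Lmodule K L & Lmodule_isLieAlgebra K L }.

(* Vector K L is what makes L finite-dimensional over K. *)
#[short(type="finDimLieAlgType")]
HB.structure Definition FinDimLieAlgebra (K : fieldType) :=
  { L of Vector K L & LieAlgebra K L }.

Definition lie_abelian (K : fieldType) (L : lieAlgType K) : Prop :=
  forall x y : L, lie x y = 0.

Lemma lieC (K : fieldType) (L : lieAlgType K) (x y : L) :
  lie x y = - lie y x.
Proof.
have addl (a b c : L) : lie (a + b) c = lie a c + lie b c.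
  by have := (@lie_is_bilinear K L).1 c 1 a b; rewrite /= !scale1r.
have addr (a b c : L) : lie a (b + c) = lie a b + lie a c.
  by have := (@lie_is_bilinear K L).2 a 1 b c; rewrite /= !scale1r.
apply/eqP; rewrite -addr_eq0; apply/eqP.
by have := liexx (x + y); rewrite addl !addr !liexx add0r addr0.
Qed.

Record simple_graph := SimpleGraph {
  vertex : finType;
  adj : rel vertex;
  adj_sym : symmetric adj;
  adj_irr : irreflexive adj
}.

Definition connected_graph (G : simple_graph) : Prop :=
  (0 < #|vertex G|)%N /\ forall x y : vertex G, connect (@adj G) x y.

Section NonCommutingGraph.
Variables (F : finFieldType) (L : finDimLieAlgType F).

(* finvect_type L is the carrier of L with its finType structure, which a
   vectType over a finite field does not have canonically. *)
Definition lie_center : {set finvect_type L} :=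
  [set x : finvect_type L |
    [forall y : finvect_type L, lie (x : L) (y : L) == 0]].

Definition noncentral : finType :=
  {x : finvect_type L | x \in ~: lie_center}.

Definition noncommuting : rel noncentral :=
  fun x y => (x != y) && (lie (val x : L) (val y : L) != 0).

Lemma noncommuting_sym : symmetric noncommuting.
Proof. by move=> x y; rewrite /noncommuting eq_sym lieC oppr_eq0. Qed.

Lemma noncommuting_irr : irreflexive noncommuting.
Proof. by move=> x; rewrite /noncommuting eqxx. Qed.

Definition noncommuting_graph : simple_graph :=
  SimpleGraph noncommuting_sym noncommuting_irr.

End NonCommutingGraph.

(* Main.v *)
Require Import Defs.
From mathcomp Require Import all_boot all_order all_algebra all_field.

(** Two non-central elements x and y always have a common neighbour, so the
    graph has diameter at most 2.  The reason is that the centralizers of x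
    and of y are proper additive subgroups of L, and a group is never the union
    of two proper subgroups: any element z outside that union satisfies both
    [x, z] <> 0 and [y, z] <> 0 ([common_noncommuting]), hence is itself
    non-central.  There is at least one vertex because L is not
    abelian. *)

Import GRing.Theory.
Local Open Scope ring_scope.

Lemma lieDr (K : fieldType) (L : lieAlgType K) (x y z : L) :
  lie x (y + z) = lie x y + lie x z.
Proof. by have := (@lie_is_bilinear K L).2 x 1 y z; rewrite /= !scale1r. Qed.

(** The group-theoretic heart: if a lies outside the centralizer of x and b
    outside that of y, but neither lies outside both, then a + b does, because
    [x, a + b] = [x, a] and [y, a + b] = [y, b]. *)
Lemma common_noncommuting (K : fieldType) (L : lieAlgType K) (x y a b : L) :
  lie x a != 0 -> lie y b != 0 -> exists z, lie x z != 0 /\ lie y z != 0.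
Proof.
move=> xa yb.
have [xb0|xb] := eqVneq (lie x b) 0; last by exists b.
have [ya0|ya] := eqVneq (lie y a) 0; last by exists a.
by exists (a + b); rewrite !lieDr xb0 ya0 addr0 add0r.
Qed.

Lemma noncentralP (F : finFieldType) (L : finDimLieAlgType F)
    (x : finvect_type L) :
  reflect (exists y : L, lie (x : L) y != 0) (x \in ~: lie_center L).
Proof. by rewrite !inE negb_forall; apply: (iffP existsP). Qed.

(** Distinctness of the endpoints comes for free, since [x, x] = 0. *)
Lemma noncommutingE (F : finFieldType) (L : finDimLieAlgType F)
    (x y : noncentral L) :
  noncommuting x y = (lie (val x : L) (val y : L) != 0).
Proof.
by rewrite /noncommuting; case: eqVneq => //= ->; rewrite liexx eqxx.
Qed.

Theorem proposition2p4 (F : finFieldType) (L : finDimLieAlgType F)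
    (L_nonabelian : ~ lie_abelian L) :
  connected_graph (noncommuting_graph L).
Proof.
split=> [|x y].
  rewrite lt0n; apply/negP => /eqP/card0_eq no_vertex.
  apply: L_nonabelian => x y; apply/eqP/negPn/negP => xy.
  have x_nc : (x : finvect_type L) \in ~: lie_center L.
    by apply/noncentralP; exists y.
  by have := no_vertex (Sub (x : finvect_type L) x_nc : noncentral L).
have /noncentralP[a xa] := valP x; have /noncentralP[b yb] := valP y.
have [z [xz yz]] := common_noncommuting _ _ _ _ _ _ xa yb.
have z_nc : (z : finvect_type L) \in ~: lie_center L.
  by apply/noncentralP; exists (val x : L); rewrite lieC oppr_eq0.
pose v : noncentral L := Sub (z : finvect_type L) z_nc.
apply: (@connect_trans _ _ (v : vertex (noncommuting_graph L))); apply: connect1.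
  by rewrite /= noncommutingE.
by rewrite adj_sym /= noncommutingE.
Qed.
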